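(* Let $S$ be a set of scaled generators for a max cone $K$ in $\mathbb{R}^n_+$ (that is, every element of $S$ is scaled and $\operatorname{span}(S)=K$), and let $E$ be the set of scaled extremals in $K$. Then: (1) $E\subseteq S$. (2) Let $F=S\setminus E$. Then for any $u\in F$, the set $S\setminus\{u\}$ is a set of generators for $K$, i.e. $\operatorname{span}(S\setminus\{u\})=K$.
   Context: $\mathbb{R}^n_+$ is the set of vectors with nonnegative real entries; $a\oplus b=\max(a,b)$, extended componentwise to vectors. A max cone is a subset of $\mathbb{R}^n_+$ closed under $\oplus$ and under multiplication by nonnegative reals. $\operatorname{span}(S)$ is the set of all max combinations $\bigoplus_{x\in S}\lambda_x x$ with $\lambda_x\ge 0$ and only finitely many $\lambda_x\neq 0$; $\operatorname{span}(\emptyset)=\{0\}$. An element $u\in K$ is an extremal in $K$ if $u=v\oplus w$ with $v,w\in K$ implies $u=v$ or $u=w$. Fix an arbitrary norm $\|\cdot\|$ on $\mathbb{R}^n$; a vector $x\in\mathbb{R}^n_+$ is scaled if $\|x\|=1$. *)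

(* Defs.v *)
From mathcomp Require Import all_boot all_order all_algebra.
From mathcomp Require Import boolp classical_sets functions cardinality fsbigop.
From mathcomp Require Import reals.

Set Implicit Arguments.
Unset Strict Implicit.
Unset Printing Implicit Defensive.

Import Order.TTheory GRing.Theory Num.Theory.

Local Open Scope classical_set_scope.
Local Open Scope ring_scope.

Definition nonneg_orthant (R : realType) (n : nat) : set 'rV[R]_n :=
  [set x | forall i : 'I_n, 0 <= x ord0 i].

Definition vmax (R : realType) (n : nat) (x y : 'rV[R]_n) : 'rV[R]_n :=
  map2_mx Num.max x y.

Definition is_max_cone (R : realType) (n : nat) (K : set 'rV[R]_n) : Prop :=
  [/\ K `<=` @nonneg_orthant R n,
      forall x y, K x -> K y -> K (vmax x y)
    & forall (a : R) x, 0 <= a -> K x -> K (a *: x)].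

(* The bigop over a classical set silently returns its index 0 when infinitely
   many terms are nonzero; the finiteness condition on [lam] excludes that case.
   On nonnegative vectors, 0 is neutral for [vmax]. *)
Definition max_span (R : realType) (n : nat) (S : set 'rV[R]_n) :
    set 'rV[R]_n :=
  [set y | exists lam : 'rV[R]_n -> R,
     [/\ forall x, S x -> 0 <= lam x,
         finite_set (S `&` [set x | lam x != 0])
       & y = \big[@vmax R n/0]_(x \in S) (lam x *: x)]].

Definition extremal (R : realType) (n : nat) (K : set 'rV[R]_n) :
    set 'rV[R]_n :=
  [set u | K u /\
     forall v w, K v -> K w -> u = vmax v w -> u = v \/ u = w].

(* An arbitrary norm, passed as a function: the type ['rV[R]_n] already carries
   a canonical norm (the sup norm) in the library. Nonnegativity and [N 0 = 0]
   follow from these three conditions. *)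
Definition is_norm (R : realType) (n : nat) (N : 'rV[R]_n -> R) : Prop :=
  [/\ forall x y, N (x + y) <= N x + N y,
      forall (a : R) x, N (a *: x) = `|a| * N x
    & forall x, N x = 0 -> x = 0].

Definition scaled (R : realType) (n : nat) (N : 'rV[R]_n -> R) :
    set 'rV[R]_n :=
  [set x | nonneg_orthant x /\ N x = 1].

(* Main.v *)
Require Import Defs.
From mathcomp Require Import all_boot all_order all_algebra.
From mathcomp Require Import boolp classical_sets functions cardinality fsbigop.
From mathcomp Require Import reals.

Import Order.TTheory GRing.Theory Num.Theory.

Local Open Scope classical_set_scope.
Local Open Scope ring_scope.

(** A nonnegative vector [y] lies in the span of [S] iff every nonzero
    coordinate of [y] is attained by a multiple of an element of [S] lying below
    [y]. Let [u = vmax v w] with [v] and [w] in [K] distinct from [u], and let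
    [i] be a coordinate with [v i = u i <> 0]. A multiple of [u] attaining
    [v i] is [u] itself, which does not lie below [v]; hence [v i] is attained
    by an element of [S] other than [u], and [u] lies in the span of the rest of
    [S]. As for the extremals, a scaled extremal that is a finite max of
    multiples of elements of [S] equals one of these multiples, and scaling
    forces the factor to be 1. *)

Section MaxSpan.
Set Implicit Arguments.
Unset Strict Implicit.
Unset Printing Implicit Defensive.
Context {R : realType} {n : nat}.
Implicit Types (S K : set 'rV[R]_n) (x y u : 'rV[R]_n).

Definition attained S y (i : 'I_n) : Prop :=
  exists x, exists a : R, [/\ S x, 0 <= a,
    forall j, a * x ord0 j <= y ord0 j & a * x ord0 i = y ord0 i].

Lemma vmaxE x y i : vmax x y ord0 i = Num.max (x ord0 i) (y ord0 i).
Proof. by rewrite mxE. Qed.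

Lemma big_vmaxE (T : Type) (s : seq T) (f : T -> 'rV[R]_n) i :
  (\big[@vmax R n/0]_(x <- s) f x) ord0 i =
  \big[Num.max/0]_(x <- s) f x ord0 i.
Proof. by elim/big_rec2: _ => [|x a b _ <-]; rewrite mxE. Qed.

(** Replaces the finitely supported big operator by one over a list, on which induction is
    available. *)
Lemma max_span_seq S y : max_span S y ->
  exists s : seq 'rV[R]_n, exists lam : 'rV[R]_n -> R,
    (forall x, x \in s -> S x /\ 0 <= lam x) /\
    y = \big[@vmax R n/0]_(x <- s) (lam x *: x).
Proof.
move=> [lam [lam0 _ ->]]; exists (finite_support 0 S (fun x => lam x *: x)).
exists lam; split=> // x xs.
have Sx : S x.
  by move: xs; case: finite_supportP => // X XS _ _ /XS.
by split; [|exact: lam0].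
Qed.

Lemma max_span_attained S y : S `<=` @nonneg_orthant R n -> max_span S y ->
  forall i, y ord0 i != 0 -> attained S y i.
Proof.
move=> S0 /max_span_seq[s [lam [sS ->]]] i.
set f := fun j x => (lam x *: x) ord0 j.
have le_f j x : x \in s -> f j x <= \big[Num.max/0]_(x <- s) f j x.
  by move=> xs; apply: le_bigmax_seq.
(* A finite max is one of its terms or the default value 0; the latter is excluded at a nonzero
   coordinate. *)
have : \big[Num.max/0]_(x <- s) f i x = 0 \/
       exists2 x, x \in s & \big[Num.max/0]_(x <- s) f i x = f i x.
  rewrite big_seq; elim/big_ind: _ => [|a b ha hb|x xs]; first by left.
    by rewrite maxEle; case: ifP.
  by right; exists x.
rewrite big_vmaxE => -[->|[x xs e] _]; first by rewrite eqxx.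
have [Sx lx] := sS _ xs; exists x, (lam x); split=> // [j|].
  by rewrite big_vmaxE; have := le_f j x xs; rewrite /f mxE.
by rewrite big_vmaxE e /f mxE.
Qed.

(** Choosing a witness for each nonzero coordinate gives finitely many multiples below [y], whose
    max reaches [y] at each of these coordinates. *)
Lemma attained_max_span S y : S `<=` @nonneg_orthant R n -> nonneg_orthant y ->
  (forall i, y ord0 i != 0 -> attained S y i) -> max_span S y.
Proof.
move=> S0 y0 Sy.
have /choice[p pP] : forall i, exists p : 'rV[R]_n * R, y ord0 i != 0 ->
    [/\ S p.1, 0 <= p.2, forall j, p.2 * p.1 ord0 j <= y ord0 j
      & p.2 * p.1 ord0 i = y ord0 i].
  move=> i; have [->|/Sy[x [a h]]] := eqVneq (y ord0 i) 0; first by exists (0, 0).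
  by exists (x, a).
(* Several coordinates may choose the same vector with different factors. The largest factor serves
   them all and still keeps the multiple below [y]. A vector that is never chosen gets the default
   0, so [lam] has finite support. *)
pose lam x := \big[Num.max/0]_(i | (y ord0 i != 0) && ((p i).1 == x)) (p i).2.
have lam0 x : 0 <= lam x by apply: bigmax_ge_id.
have lam_le x j : S x -> lam x * x ord0 j <= y ord0 j.
  move=> Sx; rewrite /lam; elim/big_ind: _ => [|a b ha hb|i].
  - by rewrite mul0r y0.
  - by rewrite maxEle; case: ifP.
  - by case/andP=> /pP[_ _ h _] /eqP <-.
have fin : finite_set (S `&` [set x | lam x != 0]).
  apply: (@sub_finite_set _ _ ((fun i => (p i).1) @` [set: 'I_n])); last first.
    exact/finite_image/finite_finset.
  move=> x [_ /=]; apply: contra_neqP => xp; rewrite /lam big_pred0 // => i.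
  by apply/negP => /andP[_ /eqP ex]; apply: xp; exists i.
exists lam; split=> //.
set f := fun x => lam x *: x.
have finf : finite_set (S `&` f @^-1` [set~ 0]).
  apply: sub_finite_set fin => x [Sx /= fx]; split=> //=.
  by apply/eqP => l0; apply: fx; rewrite /f l0 scale0r.
apply/rowP => j; rewrite big_vmaxE; apply/eqP; rewrite eq_le; apply/andP; split.
  have [->|yj] := eqVneq (y ord0 j) 0; first exact: bigmax_ge_id.
  have [Sx a0 _ ej] := pP j yj; set x := (p j).1 in Sx ej.
  have le_j : y ord0 j <= f x ord0 j.
    rewrite -ej mxE ler_wpM2r ?(S0 _ Sx) //.
    by apply: (@le_bigmax_cond _ _ _ _ j _ (fun i => (p i).2)); rewrite yj eqxx.
  apply: (le_trans le_j).
  apply: (@le_bigmax_seq _ _ _ _ _ x predT (fun x => f x ord0 j)) => //.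
  (* The term at [x] is listed in the support: were it zero, [le_j] would force [y ord0 j] to
     vanish. *)
  rewrite in_finite_support // inE; split=> //= fx0.
  move: le_j; rewrite fx0 mxE => yj0.
  by case/eqP: yj; apply/eqP; rewrite eq_le yj0 y0.
rewrite big_seq; apply: bigmax_le => // x.
rewrite in_finite_support // => /set_mem[Sx _].
by rewrite mxE lam_le.
Qed.

(** By induction on the list: extremality makes [u] equal to the head or to the max of the tail,
    which is again in [K]. The alternative [u = 0] comes from the empty list. *)
Lemma extremal_big_vmax K u (s : seq 'rV[R]_n) (f : 'rV[R]_n -> 'rV[R]_n) :
  is_max_cone K -> extremal K u -> (forall x, x \in s -> K (f x)) ->
  u = \big[@vmax R n/0]_(x <- s) f x -> u = 0 \/ exists2 x, x \in s & u = f x.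
Proof.
move=> [_ KD KZ] [Ku uK].
have K0 : K 0 by rewrite -(scale0r u); apply: KZ.
elim: s => [|x s IH] Ks; first by rewrite big_nil; left.
have Ks' z : z \in s -> K (f z) by move=> zs; apply: Ks; rewrite inE zs orbT.
have Kx : K (f x) by apply: Ks; rewrite mem_head.
have Kbig : K (\big[@vmax R n/0]_(x <- s) f x).
  by rewrite big_seq; elim/big_ind: _.
rewrite big_cons => /(uK _ _ Kx Kbig)[->|/(IH Ks')[|[z zs ->]]].
- by right; exists x; rewrite ?mem_head.
- by left.
- by right; exists z; rewrite // inE zs orbT.
Qed.

Lemma sub_max_span S : S `<=` @nonneg_orthant R n -> S `<=` max_span S.
Proof.
move=> S0 x Sx; apply: attained_max_span => // [|i _]; first exact: S0.
by exists x, 1; split=> // [j|]; rewrite mul1r.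
Qed.

Lemma attained_setD1 S u v i : S `<=` @nonneg_orthant R n ->
  max_span S v -> (forall j, v ord0 j <= u ord0 j) -> u <> v ->
  v ord0 i = u ord0 i -> u ord0 i != 0 -> attained (S `\` [set u]) u i.
Proof.
move=> S0 Sv vu uv ei ui.
have [|x [a [Sx a0 le_a ea]]] := @max_span_attained _ _ S0 Sv i.
  by rewrite ei.
exists x, a; split=> // [|j|]; last by rewrite ea.
- split=> //= xu; rewrite xu in le_a ea.
  have a1 : a = 1 by apply: (mulIf ui); rewrite mul1r ea.
  apply: uv; apply/rowP => j; apply/eqP; rewrite eq_le vu andbT.
  by have := le_a j; rewrite a1 mul1r.
- exact: le_trans (le_a j) (vu j).
Qed.

Lemma max_span_ge0 S : S `<=` @nonneg_orthant R n ->
  max_span S `<=` @nonneg_orthant R n.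
Proof.
move=> S0 y Sy i; have [->//|] := eqVneq (y ord0 i) 0.
move=> /(max_span_attained S0 Sy)[x [a [Sx a0 _ <-]]].
by rewrite mulr_ge0 ?(S0 _ Sx).
Qed.

(** Attainment is transitive: where [y] is attained by a multiple of [u], that [u] can be replaced
    by an element of the rest attaining the same coordinate of [u], and the factors multiply. *)
Lemma max_span_setD1 S u : S `<=` @nonneg_orthant R n ->
  max_span (S `\` [set u]) u -> max_span (S `\` [set u]) = max_span S.
Proof.
move=> S0 Su; have S'0 : S `\` [set u] `<=` @nonneg_orthant R n.
  by move=> x [/S0].
apply/seteqP; split=> y Sy.
  apply: attained_max_span => // [|i]; first exact: (max_span_ge0 S'0).
  by move=> /(max_span_attained S'0 Sy)[x [a [[Sx _] a0 le_a ea]]]; exists x, a.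
apply: attained_max_span => // [|i yi]; first exact: (max_span_ge0 S0).
have [x [a [Sx a0 le_a ea]]] := max_span_attained S0 Sy yi.
have [xu|xu] := pselect (x = u); last by exists x, a.
have ui : u ord0 i != 0.
  by apply: contra_neq yi => ui; rewrite -ea xu ui mulr0.
have [z [b [Sz b0 le_b eb]]] := max_span_attained S'0 Su ui.
exists z, (a * b); split=> // [|j|]; first exact: mulr_ge0.
- by apply: le_trans (le_a j); rewrite xu -mulrA ler_wpM2l.
- by rewrite -mulrA eb -xu.
Qed.

Lemma not_extremal_max_span S u : S `<=` @nonneg_orthant R n ->
  max_span S u -> ~ extremal (max_span S) u -> max_span (S `\` [set u]) u.
Proof.
move=> S0 Su uNext.
have [v [w [Sv Sw uvw uv uw]]] : exists v, exists w,
    [/\ max_span S v, max_span S w, u = vmax v w, u <> v & u <> w].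
  apply: contrapT => h; apply: uNext; split=> // v w Sv Sw e.
  apply: contrapT => /not_orP[uv uw]; apply: h.
  by exists v, w.
have vu j : v ord0 j <= u ord0 j by rewrite uvw vmaxE le_max lexx.
have wu j : w ord0 j <= u ord0 j by rewrite uvw vmaxE le_max lexx orbT.
apply: attained_max_span => [x [/S0//]||i ui]; first exact: max_span_ge0 Su.
(* The choice between [v] and [w] depends on the coordinate, so both must differ from [u]. *)
have : u ord0 i = v ord0 i \/ u ord0 i = w ord0 i.
  by rewrite uvw vmaxE maxEle; case: ifP; [right|left].
by case=> e; [exact: attained_setD1 vu uv _ _|exact: attained_setD1 wu uw _ _].
Qed.

End MaxSpan.

Theorem theorem16 (R : realType) (n : nat) (N : 'rV[R]_n -> R)
    (S K E : set 'rV[R]_n) :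
  is_norm N ->
  is_max_cone K ->
  S `<=` scaled N ->
  max_span S = K ->
  E = extremal K `&` scaled N ->
  E `<=` S /\
  (forall F : set 'rV[R]_n, F = S `\` E ->
     forall u, F u -> max_span (S `\` [set u]) = K).
Proof.
move=> [_ NZ _] Kcone SN SK ->.
have S0 : S `<=` @nonneg_orthant R n by move=> x /SN[].
split=> [u [uext [_ Nu]]|_ -> u [Su uNE]].
  have : K u by case: uext.
  rewrite -SK => /max_span_seq[s [lam [sS eu]]].
  have Ks x : x \in s -> K (lam x *: x).
    move=> /sS[Sx lx]; case: Kcone => _ _; apply=> //.
    by rewrite -SK; exact: sub_max_span.
  have [u0|[x xs ux]] := extremal_big_vmax Kcone uext Ks eu.
    (* Homogeneity with factor 0 gives [N 0 = 0], so a scaled vector is nonzero. *)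
    have := NZ 0 0; rewrite scale0r normr0 mul0r -u0 Nu.
    by move=> /eqP; rewrite oner_eq0.
  have [Sx lx] := sS _ xs; move: Nu.
  rewrite ux NZ (SN _ Sx).2 mulr1 ger0_norm // => ->.
  by rewrite scale1r.
rewrite -SK; apply: max_span_setD1 => //.
apply: not_extremal_max_span => //; first exact: sub_max_span.
by move=> uext; apply: uNE; rewrite -SK; split=> //; exact: SN.
Qed.
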